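(* Let $(A, \dashv, \vdash, \cdot, \varepsilon, \alpha)$ be a Hom-tridendriform color algebra. Then $(A, \dashv, \vdash', \varepsilon, \alpha)$ is a Hom-dendriform color algebra, where $$x\vdash' y:=x\vdash y+x\cdot y$$ for all $x, y\in\mathcal{H}(A)$.
   Context: All vector spaces are over a field $\mathbb{K}$ of characteristic different from $2$, $G$ is an abelian group, and a linear map or bilinear map between $G$-graded spaces is called even if it preserves degree. $\mathcal{H}(A)$ denotes the set of homogeneous elements of a $G$-graded space $A$. A bicharacter on $G$ is a map $\varepsilon:G\times G\to\mathbb{K}^*$ with $\varepsilon(a,b)\varepsilon(b,a)=1$, $\varepsilon(a,b+c)=\varepsilon(a,b)\varepsilon(a,c)$, $\varepsilon(a+b,c)=\varepsilon(a,c)\varepsilon(b,c)$ for all $a,b,c\in G$. For homogeneous $x,y$ of degrees $a,b$ one writes $\varepsilon(x,y):=\varepsilon(a,b)$. A Hom-tridendriform color algebra $(T,\dashv,\vdash,\cdot,\varepsilon,\alpha)$ is a $G$-graded linear space $T$ with three even bilinear maps $\dashv,\vdash,\cdot$, a bicharacter $\varepsilon$ and an even linear map $\alpha:T\to T$ such that for all $x,y,z\in\mathcal{H}(T)$: $(x\dashv y)\dashv\alpha(z)=\alpha(x)\dashv(y\dashv z+\varepsilon(z, y)\,y\vdash z+\varepsilon(z, y)\,y\cdot z)$; $(x\vdash y)\dashv\alpha(z)=\varepsilon(z, x)\,\alpha(x)\vdash(y\dashv z)$; $\alpha(x)\vdash(y\vdash z)=(\varepsilon(x, y)\,x\dashv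 y+x\vdash y+x\cdot y)\vdash\alpha(z)$; $(x\dashv y)\cdot\alpha(z)=\varepsilon(y, x)\,\alpha(x)\cdot(y\vdash z)$; $(x\vdash y)\cdot\alpha(z)=\alpha(x)\vdash(y\cdot z)$; $(x\cdot y)\dashv\alpha(z)=\varepsilon(z, x)\,\alpha(x)\cdot(y\dashv z)$; $(x\cdot y)\cdot\alpha(z)=\alpha(x)\cdot(y\cdot z)$. A Hom-dendriform color algebra $(A,\dashv,\vdash,\varepsilon,\alpha)$ is the case where the product $\cdot$ is identically zero, i.e. for all $x,y,z\in\mathcal{H}(A)$: $(x\dashv y)\dashv\alpha(z)=\alpha(x)\dashv(y\dashv z+\varepsilon(z, y)\,y\vdash z)$; $(x\vdash y)\dashv\alpha(z)=\varepsilon(z, x)\,\alpha(x)\vdash(y\dashv z)$; $\alpha(x)\vdash(y\vdash z)=(\varepsilon(x, y)\,x\dashv y+x\vdash y)\vdash\alpha(z)$. *)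

(* Defs.v *)
From mathcomp Require Import all_boot all_order all_algebra.
From mathcomp Require Import boolp classical_sets.

Set Implicit Arguments.
Unset Strict Implicit.
Unset Printing Implicit Defensive.

Import GRing.Theory.
Local Open Scope ring_scope.

(* G is an arbitrary, possibly infinite, abelian group, so directness of the
   sum of the components is expressed through finite families of indices. *)
Record is_grading (K : fieldType) (G : zmodType) (T : lmodType K)
    (comp : G -> set T) : Prop := IsGrading {
  grading_submod : forall a : G, submod_closed [in comp a];
  grading_span : forall x : T, exists (s : seq G) (f : G -> T),
    [/\ uniq s, forall a : G, f a \in comp a & x = \sum_(a <- s) f a];
  grading_direct : forall (s : seq G) (f : G -> T), uniq s ->
    (forall a : G, f a \in comp a) -> \sum_(a <- s) f a = 0 ->
    {in s, forall a, f a = 0}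
}.

Record is_bicharacter (K : fieldType) (G : zmodType) (eps : G -> G -> K) :
    Prop := IsBicharacter {
  bichar_neq0 : forall a b : G, eps a b != 0;
  bichar_skew : forall a b : G, eps a b * eps b a = 1;
  bicharDr : forall a b c : G, eps a (b + c) = eps a b * eps a c;
  bicharDl : forall a b c : G, eps (a + b) c = eps a c * eps b c
}.

Section HomColorAlgebras.

Context (K : fieldType) (G : zmodType) (T : lmodType K) (comp : G -> set T).

Definition even_linear (alpha : T -> T) : Prop :=
  linear alpha /\ forall a, {in comp a, forall x, alpha x \in comp a}.

Definition even_bilinear (op : T -> T -> T) : Prop :=
  bilinear_for *:%R *:%R op /\
  forall a b, {in comp a & comp b, forall x y, op x y \in comp (a + b)}.

Section Identities.

Context (dashv vdash dot : T -> T -> T) (eps : G -> G -> K) (alpha : T -> T).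

Local Notation "x ⊣ y" := (dashv x y) (at level 38, left associativity).
Local Notation "x ⊢ y" := (vdash x y) (at level 38, left associativity).
Local Notation "x ⋅ y" := (dot x y) (at level 38, left associativity).

(* In the identities a, b, c are the degrees of x, y, z, so that for instance
   eps(z, y) is eps c b. The zero vector lies in every component, but every
   identity is trivial as soon as one of x, y, z is zero. *)
Record is_hom_tridendriform_color : Prop := IsHomTridendriformColor {
  tridend_grading : is_grading comp;
  tridend_dashv : even_bilinear dashv;
  tridend_vdash : even_bilinear vdash;
  tridend_dot : even_bilinear dot;
  tridend_eps : is_bicharacter eps;
  tridend_alpha : even_linear alpha;
  tridend_ax1 : forall a b c x y z,
    x \in comp a -> y \in comp b -> z \in comp c ->
    (x ⊣ y) ⊣ alpha z
      = alpha x ⊣ (y ⊣ z + eps c b *: (y ⊢ z) + eps c b *: (y ⋅ z));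
  tridend_ax2 : forall a b c x y z,
    x \in comp a -> y \in comp b -> z \in comp c ->
    (x ⊢ y) ⊣ alpha z = eps c a *: (alpha x ⊢ (y ⊣ z));
  tridend_ax3 : forall a b c x y z,
    x \in comp a -> y \in comp b -> z \in comp c ->
    alpha x ⊢ (y ⊢ z)
      = (eps a b *: (x ⊣ y) + x ⊢ y + x ⋅ y) ⊢ alpha z;
  tridend_ax4 : forall a b c x y z,
    x \in comp a -> y \in comp b -> z \in comp c ->
    (x ⊣ y) ⋅ alpha z = eps b a *: (alpha x ⋅ (y ⊢ z));
  tridend_ax5 : forall a b c x y z,
    x \in comp a -> y \in comp b -> z \in comp c ->
    (x ⊢ y) ⋅ alpha z = alpha x ⊢ (y ⋅ z);
  tridend_ax6 : forall a b c x y z,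
    x \in comp a -> y \in comp b -> z \in comp c ->
    (x ⋅ y) ⊣ alpha z = eps c a *: (alpha x ⋅ (y ⊣ z));
  tridend_ax7 : forall a b c x y z,
    x \in comp a -> y \in comp b -> z \in comp c ->
    (x ⋅ y) ⋅ alpha z = alpha x ⋅ (y ⋅ z)
}.

Record is_hom_dendriform_color : Prop := IsHomDendriformColor {
  dend_grading : is_grading comp;
  dend_dashv : even_bilinear dashv;
  dend_vdash : even_bilinear vdash;
  dend_eps : is_bicharacter eps;
  dend_alpha : even_linear alpha;
  dend_ax1 : forall a b c x y z,
    x \in comp a -> y \in comp b -> z \in comp c ->
    (x ⊣ y) ⊣ alpha z = alpha x ⊣ (y ⊣ z + eps c b *: (y ⊢ z));
  dend_ax2 : forall a b c x y z,
    x \in comp a -> y \in comp b -> z \in comp c ->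
    (x ⊢ y) ⊣ alpha z = eps c a *: (alpha x ⊢ (y ⊣ z));
  dend_ax3 : forall a b c x y z,
    x \in comp a -> y \in comp b -> z \in comp c ->
    alpha x ⊢ (y ⊢ z) = (eps a b *: (x ⊣ y) + x ⊢ y) ⊢ alpha z
}.

End Identities.

End HomColorAlgebras.

(* Main.v *)
Require Import Defs.
From mathcomp Require Import all_boot all_order all_algebra.
From mathcomp Require Import boolp classical_sets.

Import GRing.Theory.

Local Open Scope ring_scope.

(** Expanding each dendriform identity for [vdash + dot] bilinearly splits it into tridendriform
    ones. The first is [ax1] with its two equal coefficients factored; the second is [ax2] plus
    [ax6], which share the factor [eps c a]; the third is the sum of [ax3], [ax4], [ax5] and [ax7].
    Evenness of the new product ([even_bilinearD]) holds because each component is a subspace. *)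

Section EvenBilinear.

Context {K : fieldType} {G : zmodType} {T : lmodType K} {comp : G -> set T}.
Context {op : T -> T -> T} (op_even : even_bilinear comp op).

Lemma even_bilinearDl x y z : op (x + y) z = op x z + op y z.
Proof. by have [[/(_ z 1 x y)/=]] := op_even; rewrite !scale1r. Qed.

Lemma even_bilinearDr x y z : op z (x + y) = op z x + op z y.
Proof. by have [[_ /(_ z 1 x y)/=]] := op_even; rewrite !scale1r. Qed.

Lemma even_bilinearZl k x z : op (k *: x) z = k *: op x z.
Proof.
have op0 : op 0 z = 0 by apply: (addrI (op 0 z)); rewrite -even_bilinearDl !addr0.
by have [[/(_ z k x 0)/=]] := op_even; rewrite op0 !addr0.
Qed.

End EvenBilinear.

Lemma even_bilinearD (K : fieldType) (G : zmodType) (T : lmodType K)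
    (comp : G -> set T) (op1 op2 : T -> T -> T) :
  is_grading comp -> even_bilinear comp op1 -> even_bilinear comp op2 ->
  even_bilinear comp (fun x y => op1 x y + op2 x y).
Proof.
move=> [comp_submod _ _] [[lin1l lin1r] even1] [[lin2l lin2r] even2].
split; first split.
- move=> z k x y /=.
  by move: (lin1l z k x y) (lin2l z k x y) => /= -> ->; rewrite scalerDr addrACA.
- move=> z k x y /=.
  by move: (lin1r z k x y) (lin2r z k x y) => /= -> ->; rewrite scalerDr addrACA.
move=> a b x y xa yb; have [_ compP] := comp_submod (a + b).
(* [submod_closed] gives closure under [k *: u + v]; a plain sum is the case [k = 1]. *)
rewrite -[op1 x y]scale1r.
exact: (compP 1 _ _ (even1 _ _ _ _ xa yb) (even2 _ _ _ _ xa yb)).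
Qed.

Theorem proposition3p5 (K : fieldType) (K_char : 2%N \notin [pchar K])
    (G : zmodType) (A : lmodType K) (comp : G -> set A)
    (dashv vdash dot : A -> A -> A) (eps : G -> G -> K) (alpha : A -> A) :
  is_hom_tridendriform_color comp dashv vdash dot eps alpha ->
  is_hom_dendriform_color comp dashv (fun x y : A => vdash x y + dot x y)
    eps alpha.
Proof.
move=> [gr Bl Br Bd beps ealpha ax1 ax2 ax3 ax4 ax5 ax6 ax7].
split=> //; first exact: even_bilinearD.
- move=> a b c x y z xa yb zc.
  by rewrite (ax1 a b c) // scalerDr addrA.
- move=> a b c x y z xa yb zc.
  by rewrite (even_bilinearDl Bl) (ax2 a b c) // (ax6 a b c) // scalerDr.
move=> a b c x y z xa yb zc.
rewrite (even_bilinearDr Br) (even_bilinearDr Bd).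
(* Once the [vdash] terms given by [ax3] cancel, only products under [dot] remain; [ax5] and [ax7]
   already put two of the three in the form [_ ⋅ alpha z]. *)
rewrite (ax3 a b c) // -(ax5 a b c) // -(ax7 a b c) // -!addrA; congr (_ + _).
rewrite !(even_bilinearDl Bd) (even_bilinearZl Bd).
(* Skew-symmetry cancels the factor eps b a from axiom 4 against the eps a b of axiom 3. *)
by rewrite (ax4 a b c) // scalerA (bichar_skew beps) scale1r addrCA.
Qed.
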